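(* Let $p>2$ be a prime, $R=\mathbb{Z}_p[u,v]$, $\lambda=1+u\lambda_2+v\lambda_3$ with $\lambda_2,\lambda_3\in\mathbb{Z}_p$, and let $\mathcal{C}$ be a $\mathbb{Z}_p\mathbb{Z}_p[u,v]$-additive $\lambda$-constacyclic code of length $(\alpha,p-1)$. Then $\mathcal{C}$ is an $R[x]$-submodule of $R_{\alpha,p-1,\lambda}$ given by $$\mathcal{C}=\langle (f_1(x),0),\ (f_2(x),g(\lambda x)+ua(\lambda x)+vp_1(\lambda x)),\ (f_3(x),vb(\lambda x))\rangle$$ for some $f_1,f_2,f_3,g,a,b,p_1\in\mathbb{Z}_p[x]$ with $f_1\mid(x^\alpha-1)$, $a\mid g\mid(x^{p-1}-1)$ and $b\mid g\mid(x^{p-1}-1)$ in $\mathbb{Z}_p[x]$.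
   Context: $R=\mathbb{Z}_p[u,v]$ denotes the ring $\mathbb{Z}_p+u\mathbb{Z}_p+v\mathbb{Z}_p$ with $u^2=v^2=uv=vu=0$; $\rho:R\to\mathbb{Z}_p$, $\rho(a+ub+vc)=a$, extended coefficientwise to $R[x]\to\mathbb{Z}_p[x]$. A $\mathbb{Z}_p\mathbb{Z}_p[u,v]$-additive code of length $(\alpha,\beta)$ is an $R$-submodule of $\mathbb{Z}_p^\alpha\times R^\beta$, where $z*(c,d)=(\rho(z)c,zd)$; it is additive $\lambda$-constacyclic if it is closed under $(c_0,\dots,c_{\alpha-1},d_0,\dots,d_{\beta-1})\mapsto(c_{\alpha-1},c_0,\dots,c_{\alpha-2},\lambda d_{\beta-1},d_0,\dots,d_{\beta-2})$. $R_{\alpha,\beta,\lambda}=\mathbb{Z}_p[x]/\langle x^\alpha-1\rangle\times R[x]/\langle x^\beta-\lambda\rangle$ is an $R[x]$-module via $\gamma*(c,d)=(\rho(\gamma)c,\gamma d)$, and words $(c,d)$ are identified with $(\sum c_ix^i,\sum d_ix^i)\in R_{\alpha,\beta,\lambda}$. $\langle\cdot\rangle$ is the $R[x]$-submodule generated. *)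

(* Defs.v *)
(* MathComp. *)
From HB Require Import structures.
From mathcomp Require Import all_boot all_order all_algebra.
From mathcomp Require Import ring.

Set Implicit Arguments.
Unset Strict Implicit.
Unset Printing Implicit Defensive.

Import GRing.Theory.
Local Open Scope ring_scope.

(* The ring Z_p[u,v] = Z_p + u Z_p + v Z_p with u^2 = v^2 = uv = vu = 0:
   UV a b c stands for a + u b + v c.  'F_p is Z_p only for p prime. *)
Record Zpuv (p : nat) := UV {
  coef1 : 'F_p;
  coefu : 'F_p;
  coefv : 'F_p
}.
Arguments UV {p}.

Section RingStructure.
Variable p : nat.
Implicit Types x y z : Zpuv p.

Definition triple_of_Zpuv x := (coef1 x, coefu x, coefv x).
Definition Zpuv_of_triple (t : 'F_p * 'F_p * 'F_p) := UV t.1.1 t.1.2 t.2.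
Lemma triple_of_ZpuvK : cancel triple_of_Zpuv Zpuv_of_triple.
Proof. by case. Qed.

HB.instance Definition _ := Equality.copy (Zpuv p) (can_type triple_of_ZpuvK).
HB.instance Definition _ := Choice.copy (Zpuv p) (can_type triple_of_ZpuvK).
HB.instance Definition _ := Countable.copy (Zpuv p) (can_type triple_of_ZpuvK).
HB.instance Definition _ : isFinite (Zpuv p) := CanIsFinite triple_of_ZpuvK.

Definition Zpuv_add x y :=
  UV (coef1 x + coef1 y) (coefu x + coefu y) (coefv x + coefv y).
Definition Zpuv_opp x := UV (- coef1 x) (- coefu x) (- coefv x).
Definition Zpuv_mul x y :=
  UV (coef1 x * coef1 y)
     (coef1 x * coefu y + coefu x * coef1 y)
     (coef1 x * coefv y + coefv x * coef1 y).

Lemma Zpuv_addA : associative Zpuv_add.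
Proof. by move=> x y z; rewrite /Zpuv_add /= !addrA. Qed.
Lemma Zpuv_addC : commutative Zpuv_add.
Proof. by move=> x y; congr UV; rewrite addrC. Qed.
Lemma Zpuv_add0 : left_id (UV 0 0 0) Zpuv_add.
Proof. by case=> a b c; rewrite /Zpuv_add /= !add0r. Qed.
Lemma Zpuv_addN : left_inverse (UV 0 0 0) Zpuv_opp Zpuv_add.
Proof. by move=> x; rewrite /Zpuv_add /= !addNr. Qed.

HB.instance Definition _ :=
  GRing.isZmodule.Build (Zpuv p) Zpuv_addA Zpuv_addC Zpuv_add0 Zpuv_addN.

Lemma Zpuv_mulA : associative Zpuv_mul.
Proof. by move=> x y z; congr UV => /=; ring. Qed.
Lemma Zpuv_mulC : commutative Zpuv_mul.
Proof. by move=> x y; congr UV => /=; ring. Qed.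
Lemma Zpuv_mul1 : left_id (UV 1 0 0) Zpuv_mul.
Proof. by case=> a b c; congr UV => /=; ring. Qed.
Lemma Zpuv_mulD : left_distributive Zpuv_mul +%R.
Proof. by move=> x y z; congr UV => /=; ring. Qed.
Lemma Zpuv_1neq0 : UV 1 0 0 != 0 :> Zpuv p.
Proof. by apply/eqP => -[/eqP]; rewrite oner_eq0. Qed.

HB.instance Definition _ := GRing.Zmodule_isComNzRing.Build (Zpuv p)
  Zpuv_mulA Zpuv_mulC Zpuv_mul1 Zpuv_mulD Zpuv_1neq0.

Definition cst (a : 'F_p) : Zpuv p := UV a 0 0.
Definition uu : Zpuv p := UV 0 1 0.
Definition vv : Zpuv p := UV 0 0 1.

Lemma uu_sqr : uu * uu = 0. Proof. by congr UV => /=; ring. Qed.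
Lemma vv_sqr : vv * vv = 0. Proof. by congr UV => /=; ring. Qed.
Lemma uu_vv : uu * vv = 0. Proof. by congr UV => /=; ring. Qed.
Lemma ZpuvE x : x = cst (coef1 x) + uu * cst (coefu x) + vv * cst (coefv x).
Proof. by case: x => a b c; congr UV => /=; ring. Qed.

Fact cst_is_zmod_morphism : zmod_morphism cst.
Proof. by move=> a b; congr UV => /=; ring. Qed.
Fact cst_is_monoid_morphism : monoid_morphism cst.
Proof. by split=> // a b; congr UV => /=; ring. Qed.
HB.instance Definition _ :=
  GRing.isZmodMorphism.Build 'F_p (Zpuv p) cst cst_is_zmod_morphism.
HB.instance Definition _ :=
  GRing.isMonoidMorphism.Build 'F_p (Zpuv p) cst cst_is_monoid_morphism.

Definition rho x : 'F_p := coef1 x.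
Fact rho_is_zmod_morphism : zmod_morphism rho.
Proof. by []. Qed.
Fact rho_is_monoid_morphism : monoid_morphism rho.
Proof. by []. Qed.
HB.instance Definition _ :=
  GRing.isZmodMorphism.Build (Zpuv p) 'F_p rho rho_is_zmod_morphism.
HB.instance Definition _ :=
  GRing.isMonoidMorphism.Build (Zpuv p) 'F_p rho rho_is_monoid_morphism.

End RingStructure.

Arguments uu {p}.
Arguments vv {p}.

(* Z_p^alpha x R^beta as an R-module, with z * (c, d) = (rho(z) c, z d). *)
Definition word (p alpha beta : nat) : Type :=
  ('rV['F_p]_alpha * 'rV[Zpuv p]_beta)%type.

Section WordModule.
Variables p alpha beta : nat.
Local Notation W := (word p alpha beta).

HB.instance Definition _ :=
  Finite.copy W ('rV['F_p]_alpha * 'rV[Zpuv p]_beta)%type.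
HB.instance Definition _ :=
  GRing.Zmodule.copy W ('rV['F_p]_alpha * 'rV[Zpuv p]_beta)%type.

Definition word_scale (z : Zpuv p) (w : W) : W := (rho z *: w.1, z *: w.2).

Lemma word_scaleA a b w :
  word_scale a (word_scale b w) = word_scale (a * b) w.
Proof. by rewrite /word_scale /= !scalerA. Qed.
Lemma word_scale1 : left_id 1 word_scale.
Proof. by case=> c d; rewrite /word_scale (rmorph1 (@rho p)) !scale1r. Qed.
Lemma word_scaleDr : right_distributive word_scale +%R.
Proof. by move=> a w1 w2; congr (_, _) => /=; rewrite scalerDr. Qed.
Lemma word_scaleDl w : {morph word_scale^~ w : a b / a + b}.
Proof. by move=> a b; congr (_, _) => /=; rewrite scalerDl. Qed.

HB.instance Definition _ := GRing.Zmodule_isLmodule.Build (Zpuv p) W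
  word_scaleA word_scale1 word_scaleDr word_scaleDl.

End WordModule.

(* (c_0, .., c_(n-1)) |-> (lam c_(n-1), c_0, .., c_(n-2)); ord_pred is the
   cyclic predecessor on 'I_n, so ord_pred 0 = n - 1. *)
Definition constashift (A : nzRingType) (lam : A) (n : nat) (c : 'rV[A]_n) :
    'rV[A]_n :=
  \row_i (if i == 0 :> nat then lam * c 0 (ord_pred i) else c 0 (ord_pred i)).

Definition word_shift (p alpha beta : nat) (lam : Zpuv p)
    (w : word p alpha beta) : word p alpha beta :=
  (constashift 1 w.1, constashift lam w.2).

Definition additive_code (p alpha beta : nat)
    (C : {set word p alpha beta}) : Prop := submod_closed C.

Definition additive_constacyclic (p alpha beta : nat) (lam : Zpuv p)
    (C : {set word p alpha beta}) : Prop :=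
  additive_code C /\ {in C, forall w, word_shift lam w \in C}.

(* R_(alpha,beta,lambda) = Z_p[x]/<x^alpha - 1> x R[x]/<x^beta - lambda> as an
   R[x]-module, with gamma * (c, d) = (rho(gamma) c, gamma d).
   {poly %/ h} is the quotient by h only when h is monic of positive degree,
   so alpha and beta must be positive. *)
Definition polyword (p alpha beta : nat) (lam : Zpuv p) : Type :=
  ({poly %/ ('X^alpha - 1 : {poly 'F_p})}
   * {poly %/ ('X^beta - lam%:P : {poly Zpuv p})})%type.

Section PolywordModule.
Variables (p alpha beta : nat) (lam : Zpuv p).
Local Notation M := (polyword alpha beta lam).
Local Notation M0 := ({poly %/ ('X^alpha - 1 : {poly 'F_p})}
  * {poly %/ ('X^beta - lam%:P : {poly Zpuv p})})%type.

HB.instance Definition _ := Finite.copy M M0.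
HB.instance Definition _ := GRing.Zmodule.copy M M0.

Definition polyword_scale (gamma : {poly Zpuv p}) (m : M) : M :=
  (in_qpoly ('X^alpha - 1) (map_poly (@rho p) gamma) * m.1,
   in_qpoly ('X^beta - lam%:P) gamma * m.2).

Lemma polyword_scaleA a b m :
  polyword_scale a (polyword_scale b m) = polyword_scale (a * b) m.
Proof. by rewrite /polyword_scale /= !rmorphM /= !mulrA. Qed.
Lemma polyword_scale1 : left_id 1 polyword_scale.
Proof. by case=> c d; rewrite /polyword_scale !rmorph1 !mul1r. Qed.
Lemma polyword_scaleDr : right_distributive polyword_scale +%R.
Proof. by move=> a m1 m2; congr (_, _) => /=; rewrite mulrDr. Qed.
Lemma polyword_scaleDl m : {morph polyword_scale^~ m : a b / a + b}.
Proof. by move=> a b; congr (_, _) => /=; rewrite !rmorphD /= mulrDl. Qed.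

HB.instance Definition _ := GRing.Zmodule_isLmodule.Build {poly Zpuv p} M
  polyword_scaleA polyword_scale1 polyword_scaleDr polyword_scaleDl.

Definition polyclass (f : {poly 'F_p}) (d : {poly Zpuv p}) : M :=
  (in_qpoly _ f, in_qpoly _ d).

(* The identification (c, d) = (sum c_i x^i, sum d_i x^i). *)
Definition word_poly (w : word p alpha beta) : M :=
  polyclass (rVpoly w.1) (rVpoly w.2).

Definition code_poly (C : {set word p alpha beta}) : {set M} :=
  [set word_poly w | w in C].

End PolywordModule.

Arguments polyclass {p} alpha beta lam f d.

Definition in_span (A : nzRingType) (M : lmodType A) (gs : seq M) (m : M) :
    Prop :=
  exists r : 'I_(size gs) -> A, m = \sum_i r i *: gs`_i.

(* f(lam x) in R[x], for f in Z_p[x]. *)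
Definition subst_lam (p : nat) (lam : Zpuv p) (f : {poly 'F_p}) :
    {poly Zpuv p} :=
  map_poly (@cst p) f \Po (lam *: 'X).

(* Main.v *)
(* In R[x] the maps x -> lambda x and x -> lambda^(p-1) x are mutually inverse,
   since lambda^p = 1, and x -> lambda x sends x^(p-1) - 1 to a unit multiple of
   x^(p-1) - lambda.  So the second components of the code pull back to an ideal
   J of R[x] containing h = x^(p-1) - 1.  Let <g>, <a>, <b> be the ideals of
   Z_p[x] formed by the residues of elements of J, by the u-parts of elements
   u a + v q of J, and by the f with v f in J.  As h is separable, g is coprime
   to h / g, which forces g itself into J; the same coprimality shows that
   g + u a + v q alone recovers both g and u a + v q modulo h.  Lifting these
   two generators to the code leaves the kernel of the second projection, an
   ideal of Z_p[x] containing x^alpha - 1. *)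
Require Import Defs.
From HB Require Import structures.
From mathcomp Require Import all_boot all_order all_algebra.
From mathcomp Require Import separable cyclotomic ring.
From Stdlib Require Import Classical_Prop.

Set Implicit Arguments.
Unset Strict Implicit.
Unset Printing Implicit Defensive.

Import GRing.Theory.
Local Open Scope ring_scope.

(** * Ideals as predicates; principality over a field *)

Definition ideal_pred (A : comNzRingType) (I : A -> Prop) : Prop :=
  forall c x y, I x -> I y -> I (c * x + y).

Section IdealPred.
Variables (A : comNzRingType) (I : A -> Prop).
Hypothesis idI : ideal_pred I.

(** [ideal_pred] also admits the empty predicate, so 0 is reached through a known member. *)
Lemma ideal_pred0 x : I x -> I 0.
Proof. by move=> Ix; have := idI (-1) Ix Ix; rewrite mulN1r addNr. Qed.

Lemma ideal_predM c x : I x -> I (c * x).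
Proof. by move=> Ix; rewrite -[_ * _]addr0; apply: idI (ideal_pred0 Ix). Qed.

Lemma ideal_predD x y : I x -> I y -> I (x + y).
Proof. by move=> Ix Iy; rewrite -[x]mul1r; apply: idI. Qed.

Lemma ideal_predB x y : I x -> I y -> I (x - y).
Proof. by move=> Ix Iy; rewrite addrC -mulN1r; apply: idI. Qed.

End IdealPred.

(** Euclidean descent on the size of a nonzero member [h]: if some member is not divisible by [h],
    its remainder is a smaller nonzero member. As [I] is an arbitrary predicate, this alternative is
    settled by excluded middle. *)
Lemma poly_ideal_principal (F : fieldType) (I : {poly F} -> Prop) h :
  ideal_pred I -> I h -> h != 0 -> exists g, forall f, I f <-> g %| f.
Proof.
move=> idI; elim: (size h) {-2}h (leqnn (size h)) => [|n IHn] {}h.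
  by rewrite leqn0 size_poly_eq0 => ->.
move=> szh Ih h0.
have [[f [If hNf]]|noI] := classic (exists f, I f /\ ~~ (h %| f)).
  apply: (IHn (f %% h)) => //.
    by rewrite -ltnS (leq_trans _ szh) // ltn_modp.
  have -> : f %% h = - (f %/ h) * h + f.
    by rewrite {3}(divp_eq f h); ring.
  exact: idI.
exists h => f; split=> [If|/dvdpP[q ->]]; last exact: ideal_predM.
by have [//|hNf] := boolP (h %| f); case: noI; exists f.
Qed.

(** * Ideals and submodules over a square-zero extension of F[x] *)

(* In the application A is R[x], iota the inclusion of Z_p[x], phi the
   substitution of lambda x for x, class f d the class of (f, d), and the moduli
   are h = x^alpha - 1, k = x^(p-1) - 1 and N = x^(p-1) - lambda. *)
Section SquareZeroExtension.
Variables (F : fieldType) (A : comNzRingType).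
Variable iota : {rmorphism {poly F} -> A}.
Variables U V : A.
Hypotheses (UU0 : U * U = 0) (UV0 : U * V = 0) (VV0 : V * V = 0).
Hypothesis iota_span : forall d, exists d0 du dv : {poly F},
  d = iota d0 + U * iota du + V * iota dv.

(** Members of [J] are reduced layer by layer: a multiple of [g] clears the residue, a multiple of
    [U a + V q] the [U]-part, and [V] times a multiple of [b] remains. Separability lets one
    generator serve the first two layers. *)
Lemma square_zero_ideal (J : A -> Prop) (h : {poly F}) :
    ideal_pred J -> J (iota h) -> separable_poly h ->
  exists g a b q, [/\ a %| g, b %| g, g %| h &
    forall d, J d <-> exists c1 c2 c3,
      d = c1 * (iota g + U * iota a + V * iota q) + c2 * (V * iota b)
          + c3 * iota h].
Proof.
move=> idJ Jh sep_h.
have h0 : h != 0 by rewrite separable_poly_neq0.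
have [b Jb] : exists b, forall f, J (V * iota f) <-> b %| f.
  apply: (@poly_ideal_principal _ _ h) => //; last exact: (ideal_predM idJ).
  move=> c x y Jx Jy; rewrite rmorphD rmorphM /= mulrDr mulrCA.
  exact: idJ.
have [a Ja] : exists a, forall f,
    (exists q, J (U * iota f + V * iota q)) <-> a %| f.
  apply: (@poly_ideal_principal _ _ h) => //; last first.
    by exists 0; rewrite rmorph0 mulr0 addr0; apply: (ideal_predM idJ).
  move=> c x y [qx Jx] [qy Jy]; exists (c * qx + qy).
  rewrite !rmorphD !rmorphM /=.
  have := idJ (iota c) _ _ Jx Jy; congr J; ring.
have [g Jg] : exists g, forall f,
    (exists q1 q2, J (iota f + U * iota q1 + V * iota q2)) <-> g %| f.
  apply: (@poly_ideal_principal _ _ h) => //; last first.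
    by exists 0, 0; rewrite rmorph0 !mulr0 !addr0.
  move=> c x y [qx [rx Jx]] [qy [ry Jy]]; exists (c * qx + qy), (c * rx + ry).
  rewrite !rmorphD !rmorphM /=.
  have := idJ (iota c) _ _ Jx Jy; congr J; ring.
have [a1 [q1 Jg1]] := (Jg g).2 (dvdpp g).
have [q Jaq] := (Ja a).2 (dvdpp a).
have g_h : g %| h by apply/Jg; exists 0, 0; rewrite rmorph0 !mulr0 !addr0.
(* Multiplication by [U] or [V] kills the nilpotent part of the member with residue [g]; this yields
   [a %| g] and [b %| g]. *)
have JUg : J (U * iota g).
  have := ideal_predM idJ U Jg1; rewrite !mulrDr !mulrA UU0 UV0 !mul0r.
  by rewrite !addr0.
have JVg : J (V * iota g).
  have := ideal_predM idJ V Jg1; rewrite !mulrDr !mulrA VV0 [V * U]mulrC.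
  by rewrite UV0 !mul0r !addr0.
have [k hE] := dvdpP _ _ g_h.
have [[t s] /= st1] : exists st : {poly F} * {poly F}, st.1 * k + st.2 * g = 1.
  apply/Bezout_eq1_coprimepP.
  by move: sep_h; rewrite hE separable_mul => /and3P[].
have {}st1 : iota t * iota k + iota s * iota g = 1.
  by rewrite -!rmorphM -rmorphD st1 rmorph1.
have hE' : iota h = iota k * iota g by rewrite hE rmorphM.
(* Modulo h = k g the element s g is an idempotent fixing g; multiplying the
   generator with residue g by it kills its nilpotent part. *)
have Jg0 : J (iota g).
  have -> : iota g = iota s * iota g * (iota g + U * iota a1 + V * iota q1)
      + (- (iota s * iota a1) * (U * iota g)
      + (- (iota s * iota q1) * (V * iota g) + iota t * iota h)).
    rewrite hE' -[LHS]mul1r -st1; ring.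
  do 3?[apply: (idJ) => //]; exact: (ideal_predM idJ).
exists g, a, b, q; split=> //.
- by apply/Ja; exists 0; rewrite rmorph0 mulr0 addr0.
- by apply/Jb.
have Jgen : J (iota g + U * iota a + V * iota q).
  by rewrite -addrA; apply: (ideal_predD idJ).
move=> d; split=> [|[c1 [c2 [c3 ->]]]]; last first.
  rewrite -addrA; apply: (idJ) => //; apply: (idJ); first exact/Jb.
  exact: (ideal_predM idJ).
have [d0 [du [dv ->]]] := iota_span d => Jd.
have /dvdpP[e0 d0E] : g %| d0 by apply/Jg; exists du, dv.
move: Jd; rewrite d0E rmorphM /= => Jd.
(* Since [g] itself lies in [J], the residue can be removed without changing the [U]- and
   [V]-parts. *)
have {}Jd : J (U * iota du + V * iota dv).
  have := ideal_predB idJ Jd (ideal_predM idJ (iota e0) Jg0); congr J; ring.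
have /dvdpP[eu duE] : a %| du by apply/Ja; exists dv.
move: Jd; rewrite duE rmorphM /= => Jd.
have /dvdpP[ev dvE] : b %| dv - eu * q.
  apply/Jb; rewrite rmorphB rmorphM /=.
  have := ideal_predB idJ Jd (ideal_predM idJ (iota eu) Jaq); congr J; ring.
have {}dvE : iota dv = iota ev * iota b + iota eu * iota q.
  by rewrite -!rmorphM -rmorphD -dvE subrK.
set gen := iota g + U * iota a + V * iota q.
(* The generator gives back g, hence also u a + v q, modulo h. *)
pose w := iota s * (iota g - U * iota a - V * iota q).
(* With n = U a + V q and n^2 = 0, (g - n)(g + n) = g^2, so [w * gen] is s g^2, and s g^2 + t h = g
   (s g + t k) = g. *)
have gE : iota g = w * gen + iota t * iota h.
  have -> : w * gen = iota s * (iota g * iota g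
      - ((U * U) * (iota a * iota a) + (U * V) * (iota a * iota q *+ 2)
         + (V * V) * (iota q * iota q))).
    rewrite /w /gen; ring.
  rewrite UU0 UV0 VV0 !mul0r !addr0 subr0 hE'.
  rewrite -[LHS]mul1r -st1; ring.
(* Coefficients from g = w gen + t h and U a + V q = gen - g = (1 - w) gen - t h. *)
exists (iota e0 * w + iota eu * (1 - w)), (iota ev).
exists (iota e0 * iota t - iota eu * iota t).
transitivity (iota e0 * iota g + iota eu * (gen - iota g)
  + iota ev * (V * iota b)).
  by rewrite dvE /gen; ring.
rewrite {1 2}gE; ring.
Qed.

Variables (rho : {rmorphism A -> {poly F}}) (phi : {rmorphism A -> A}).
Variables (N nu : A) (h k : {poly F}) (M : lmodType A).
Variable class : {poly F} -> A -> M.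
Hypothesis rho_iota : forall f, rho (iota f) = f.
Hypothesis phi_surj : forall d, exists d', d = phi d'.
Hypotheses (sep_k : separable_poly k) (phi_modulus : phi (iota k) = nu * N).
Hypothesis class_linear : forall c f d f' d',
  class (rho c * f + f') (c * d + d') = c *: class f d + class f' d'.
Hypothesis class_surj : forall m, exists f d, m = class f d.
Hypothesis class0 : class 0 0 = 0.
Hypothesis class_modulus_r : forall f c, class f (c * N) = class f 0.
Hypotheses (h_neq0 : h != 0) (class_modulus_l : class h 0 = 0).

(** A generator of the kernel of the second projection ([K]), together with lifts of generators of
    its image ([J], read through [phi]), generates [P]. *)
Lemma submodule_generators (P : {pred M}) : submod_closed P ->
  exists f1 f2 f3 g a b q : {poly F},
    [/\ f1 %| h, a %| g, b %| g, g %| k &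
        forall m, m \in P <->
          exists c1 c2 c3, m = c1 *: class f1 0
            + c2 *: class f2 (phi (iota g + U * iota a + V * iota q))
            + c3 *: class f3 (phi (V * iota b))].
Proof.
case=> P0 Plin.
have PZ c m : m \in P -> c *: m \in P.
  by move=> Pm; rewrite -[_ *: _]addr0; apply: Plin.
pose J d := exists f, class f (phi d) \in P.
have idJ : ideal_pred J.
  move=> c x y [fx Px] [fy Py].
  exists (rho (phi c) * fx + fy).
  by rewrite rmorphD rmorphM class_linear; apply: Plin.
have Jh : J (iota k).
  by exists 0; rewrite phi_modulus class_modulus_r class0.
pose K f := class f 0 \in P.
have classZ c f f' :
    class (c * f + f') 0 = iota c *: class f 0 + class f' 0.
  by rewrite -class_linear rho_iota mulr0 addr0.
have idK : ideal_pred K.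
  by move=> c x y Px Py; rewrite /K classZ; apply: Plin.
have [f1 Kf1] : exists f1, forall f, K f <-> f1 %| f.
  by apply: (poly_ideal_principal idK (h := h)); rewrite // /K class_modulus_l.
have [g [a [b [q [dvd_a dvd_b dvd_g JE]]]]] := square_zero_ideal idJ Jh sep_k.
pose G2 := phi (iota g + U * iota a + V * iota q).
pose G3 := phi (V * iota b).
have [f2 Pf2] : exists f2, class f2 G2 \in P.
  by apply/JE; exists 1, 0, 0; rewrite mul1r !mul0r !addr0.
have [f3 Pf3] : exists f3, class f3 G3 \in P.
  by apply/JE; exists 0, 1, 0; rewrite mul1r !mul0r add0r addr0.
exists f1, f2, f3, g, a, b, q; split=> //.
  by apply/Kf1; rewrite /K class_modulus_l.
rewrite -/G2 -/G3 => m; split=> [Pm|[c1 [c2 [c3 ->]]]]; last first.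
  rewrite -addrA; apply: (Plin); first exact/Kf1.
  by apply: Plin => //; apply: PZ.
have [f0 [d0 mE]] := class_surj m.
have [d dE0] := phi_surj d0.
have /JE[c2 [c3 [c4 dE]]] : J d by exists f0; rewrite -dE0 -mE.
move: dE0; rewrite dE !rmorphD.
rewrite (rmorphM phi c2) (rmorphM phi c3) (rmorphM phi c4).
rewrite -/G2 -/G3 phi_modulus mulrA -addrA.
set e2 := phi c2; set e3 := phi c3; set e4 := _ * nu => {}dE.
pose r2 := rho e2; pose r3 := rho e3.
(* Scalars act on first components through [rho], so [f] is what is left of [f0] once the lifts are
   subtracted from [m]; the second component is then a multiple of [N], hence zero in its class. *)
pose f := f0 - r2 * f2 - r3 * f3.
have f0E : f0 = r2 * f2 + (r3 * f3 + f) by rewrite /f; ring.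
have {f0E dE}mE : m = e2 *: class f2 G2 + (e3 *: class f3 G3 + class f 0).
  by rewrite mE f0E dE !class_linear class_modulus_r.
have /Kf1/dvdpP[r fE] : K f.
  have -> : K f = (m - e2 *: class f2 G2 - e3 *: class f3 G3 \in P).
    by rewrite mE [e2 *: _ + _]addrC addrK [e3 *: _ + _]addrC addrK.
  rewrite addrC -scaleN1r; apply: (Plin); first exact: PZ.
  by rewrite addrC -scaleN1r; apply: Plin => //; apply: PZ.
exists (iota r), e2, e3.
have := classZ r f1 0; rewrite !addr0 class0 -fE addr0 => <-.
by rewrite mE addrA addrC -addrA addrC.
Qed.

End SquareZeroExtension.

(** * R[x] as a square-zero extension of Z_p[x] *)

Section ZpuvPoly.
Variable p : nat.
Local Notation R := (Zpuv p).
Local Notation cstp := (map_poly (@cst p)).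
Local Notation U := ((uu : R)%:P).
Local Notation V := ((vv : R)%:P).

Lemma polyUU : U * U = 0. Proof. by rewrite -polyCM uu_sqr. Qed.
Lemma polyUV : U * V = 0. Proof. by rewrite -polyCM uu_vv. Qed.
Lemma polyVV : V * V = 0. Proof. by rewrite -polyCM vv_sqr. Qed.

Lemma polyZpuvE (d : {poly R}) :
  exists d0 du dv, d = cstp d0 + U * cstp du + V * cstp dv.
Proof.
exists (map_poly (@rho p) d), (map_poly (@coefu p) d), (map_poly (@coefv p) d).
by apply/polyP=> i; rewrite !coefD !coefCM !coef_map /= !coef_map_id0 // -ZpuvE.
Qed.

End ZpuvPoly.

Lemma in_span3 (A : nzRingType) (M : lmodType A) (x y z m : M) :
  in_span [:: x; y; z] m <-> exists a b c, m = a *: x + b *: y + c *: z.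
Proof.
split=> [[r ->]|[a [b [c ->]]]].
  by rewrite !big_ord_recl big_ord0 /= addr0 !addrA; do 3?eexists.
exists (fun i => [:: a; b; c]`_i).
by rewrite !big_ord_recl big_ord0 /= addr0 !addrA.
Qed.

(** * Constacyclic shifts in quotient rings *)

Lemma in_qpoly_id (A : comNzRingType) (h : {poly A}) :
  h \is monic -> (1 < size h)%N -> in_qpoly h h = 0.
Proof.
move=> mon_h sz_h; apply: val_inj => /=.
by rewrite /mk_monic mon_h sz_h Pdiv.RingMonic.rmodpp.
Qed.

Lemma in_qpolyK (A : comNzRingType) (h : {poly A}) (m : {poly %/ h}) :
  in_qpoly h m = m.
Proof.
by apply: val_inj; apply: in_qpoly_small; apply: size_mk_monic.
Qed.

(** Multiplication by x moves the last coefficient to degree n; subtracting its multiple of x^n -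
    lam brings it back to degree 0, scaled by [lam]. *)
Lemma rVpoly_constashift (A : comNzRingType) (lam : A) n (c : 'rV[A]_n) :
    (0 < n)%N ->
  rVpoly (constashift lam c)
    = 'X * rVpoly c - ((rVpoly c)`_n.-1)%:P * ('X^n - lam%:P).
Proof.
case: n c => // n c _; apply/polyP=> i.
rewrite coefB coefXM coefCM coefB coefXn coefC.
have coef_c (j : 'I_n.+1) : c 0 j = (rVpoly c)`_j by rewrite coef_rVpoly_ord.
have [lt_i|le_i] := ltnP i n.+1.
  rewrite -[i]/(val (Ordinal lt_i)) coef_rVpoly_ord mxE !coef_c /=.
  case: i lt_i => [|i] lt_i /=.
    by rewrite modn_small //; ring.
  rewrite modnDr modn_small 1?ltnW // (ltn_eqF lt_i).
  by rewrite subrr mulr0 subr0.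
have coef0 (d : 'rV[A]_n.+1) j : (n < j)%N -> (rVpoly d)`_j = 0.
  by move=> ltj; rewrite coef_rVpoly insubF // ltnS leqNgt ltj.
rewrite (coef0 (constashift lam c)) //.
(* The length is now [n.+1], and degree [n.+1] is where the two leading terms cancel. *)
case: i le_i => // i; rewrite ltnS leq_eqVlt => /predU1P[<-|lti].
  by rewrite eqxx /= subr0 mulr1 subrr.
by rewrite /= (coef0 c i) // eqSS gtn_eqF // subrr mulr0 subr0.
Qed.

Lemma in_qpoly_constashift (A : comNzRingType) (lam : A) n (c : 'rV[A]_n)
    (h : {poly A}) :
    (0 < n)%N -> h = 'X^n - lam%:P ->
  in_qpoly h (rVpoly (constashift lam c)) = in_qpoly h ('X * rVpoly c).
Proof.
move=> n_gt0 hE; rewrite rVpoly_constashift // -hE rmorphB !rmorphM /=.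
rewrite (in_qpoly_id (h := h)) ?mulr0 ?subr0 //.
  by rewrite hE monicXnsubC.
by rewrite hE size_XnsubC.
Qed.

(** * Codes as R[x]-submodules *)

Section CodePoly.
Variables (p alpha beta : nat) (lam : Zpuv p).
Hypotheses (alpha_gt0 : (0 < alpha)%N) (beta_gt0 : (0 < beta)%N).
Local Notation class := (polyclass alpha beta lam).
Local Notation rhop := (map_poly (@rho p)).

Lemma polyclass_linear c f d f' d' :
  class (rhop c * f + f') (c * d + d') = c *: class f d + class f' d'.
Proof. by congr (_, _); rewrite /= rmorphD rmorphM. Qed.

Lemma polyclassK (m : polyword alpha beta lam) : class (val m.1) (val m.2) = m.
Proof. by case: m => m1 m2; rewrite /polyclass !in_qpolyK. Qed.

Lemma polyclass0 : class 0 0 = 0.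
Proof. by congr (_, _); rewrite rmorph0. Qed.

Lemma polyclass_modulus_r f c : class f (c * ('X^beta - lam%:P)) = class f 0.
Proof.
congr (_, _).
by rewrite rmorphM /= in_qpoly_id ?mulr0 ?rmorph0 ?monicXnsubC ?size_XnsubC.
Qed.

Lemma polyclass_modulus_l : class ('X^alpha - 1) 0 = 0.
Proof.
congr (_, _); last by rewrite rmorph0.
by rewrite in_qpoly_id ?monic_Xn_sub_1 ?size_Xn_sub_1.
Qed.

Lemma word_poly_shift (w : word p alpha beta) :
  word_poly lam (word_shift lam w) = 'X *: word_poly lam w.
Proof.
congr (_, _) => /=.
  by rewrite (in_qpoly_constashift _ alpha_gt0) // map_polyX rmorphM.
by rewrite (in_qpoly_constashift _ beta_gt0) // rmorphM.
Qed.

Lemma word_poly_linear z (w w' : word p alpha beta) :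
  word_poly lam (z *: w + w') = z%:P *: word_poly lam w + word_poly lam w'.
Proof.
by rewrite /word_poly -polyclass_linear map_polyC /= !mul_polyC -!linearP.
Qed.

(** Constants and x generate R[x]: linearity gives stability under constants, the shift gives
    stability under x, and Horner induction does the rest. *)
Lemma code_poly_submod (C : {set word p alpha beta}) :
  additive_constacyclic lam C -> submod_closed (code_poly lam C).
Proof.
move=> [[C0 Clin] Cshift].
have P0 : 0 \in code_poly lam C.
  apply/imsetP; exists 0 => //.
  by rewrite /word_poly /polyclass !linear0.
have PD m m' : m \in code_poly lam C -> m' \in code_poly lam C ->
    m + m' \in code_poly lam C.
  move=> /imsetP[w Cw ->] /imsetP[w' Cw' ->]; apply/imsetP;
    exists (1 *: w + w').
    exact: Clin.
  by rewrite word_poly_linear scale1r.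
have PC z m : m \in code_poly lam C -> z%:P *: m \in code_poly lam C.
  move=> /imsetP[w Cw ->]; apply/imsetP; exists (z *: w + 0); first exact: Clin.
  have -> : z%:P *: word_poly lam w = z%:P *: word_poly lam w + word_poly lam 0.
    by rewrite /word_poly /polyclass !linear0 addr0.
  by rewrite word_poly_linear.
have PX m : m \in code_poly lam C -> 'X *: m \in code_poly lam C.
  move=> /imsetP[w Cw ->]; apply/imsetP; exists (word_shift lam w).
    exact: Cshift.
  by rewrite word_poly_shift.
split=> // c m m' Pm Pm'; apply: (PD) => //.
elim/poly_ind: c => [|c z IHc]; first by rewrite scale0r.
by rewrite scalerDl mulrC -scalerA; apply: PD; [apply: PX|apply: PC].
Qed.

End CodePoly.

(** * The substitution of lambda x for x *)

Section LambdaSubst.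
Variables (p : nat) (p_prime : prime p) (lam2 lam3 : 'F_p) (lam : Zpuv p).
Hypothesis lamE : lam = 1 + uu * cst lam2 + vv * cst lam3.

(** Here lam = 1 + n with n^2 = 0, so lam^k = 1 + k n, and p n = 0 in characteristic p. *)
Lemma lambda_exp_prime : lam ^+ p = 1.
Proof.
have lamX k : lam ^+ k = UV 1 (lam2 *+ k) (lam3 *+ k).
  elim: k => [|k IHk]; first by rewrite expr0.
  by rewrite exprS IHk !mulrS lamE; congr UV => /=; ring.
by rewrite lamX !(mulrn_pchar (pchar_Fp p_prime)).
Qed.

Lemma lambda_predX_mul : lam ^+ p.-1 * lam = 1.
Proof. by rewrite -exprSr prednK ?prime_gt0 // lambda_exp_prime. Qed.

Lemma comp_lambdaK (d : {poly Zpuv p}) :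
  (d \Po (lam ^+ p.-1 *: 'X)) \Po (lam *: 'X) = d.
Proof.
by rewrite -comp_polyA comp_polyZ comp_polyX scalerA lambda_predX_mul scale1r
  comp_polyXr.
Qed.

(** The length p - 1 enters here: lam^(p-1) is the inverse of [lam], so factoring it out of
    lam^(p-1) x^(p-1) - 1 leaves the constant term -lam. *)
Lemma comp_lambda_modulus :
  map_poly (@cst p) ('X^(p.-1) - 1) \Po (lam *: 'X)
    = (lam ^+ p.-1)%:P * ('X^(p.-1) - lam%:P).
Proof.
rewrite rmorphB rmorph1 /= map_polyXn comp_polyB comp_Xn_poly comp_polyC.
by rewrite exprZn mulrBr mul_polyC -polyCM lambda_predX_mul.
Qed.

End LambdaSubst.

(** The exponent p - 1 is nonzero in Z_p. *)
Lemma separable_Xpred_sub_1 p : prime p ->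
  separable_poly ('X^(p.-1) - 1 : {poly 'F_p}).
Proof.
move=> p_prime; apply: separable_Xn_sub_1.
rewrite -(dvdn_pcharf (pchar_Fp p_prime)) gtnNdvd //.
  by rewrite -subn1 subn_gt0 prime_gt1.
by rewrite ltn_predL prime_gt0.
Qed.

Lemma comp_polyCl (A : comNzRingType) (c : A) (x y : {poly A}) :
  (c%:P * x) \Po y = c *: (x \Po y).
Proof. by rewrite mul_polyC comp_polyZ. Qed.

(** Brings the abstract generators, where [phi] is applied to a whole sum, to the termwise
    [subst_lam] form. *)
Lemma comp_poly_combination (A : comNzRingType) (c d : A) (x y z w : {poly A}) :
  (x + c%:P * y + d%:P * z) \Po w = x \Po w + c *: (y \Po w) + d *: (z \Po w).
Proof. by rewrite !comp_polyD !comp_polyCl. Qed.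

Theorem theorem14 (p : nat) (p_prime : prime p) (p_gt2 : (2 < p)%N)
    (alpha : nat) (alpha_gt0 : (0 < alpha)%N)
    (lam2 lam3 : 'F_p) (lam : Zpuv p)
    (lamE : lam = 1 + uu * cst lam2 + vv * cst lam3)
    (C : {set word p alpha p.-1})
    (C_constacyclic : additive_constacyclic lam C) :
  submod_closed (code_poly lam C) /\
  exists f1 f2 f3 g a b p1 : {poly 'F_p},
    [/\ f1 %| 'X^alpha - 1,
        a %| g, b %| g, g %| 'X^(p.-1) - 1 &
        forall m : polyword alpha p.-1 lam,
          m \in code_poly lam C <->
          in_span
            [:: polyclass alpha p.-1 lam f1 0;
                polyclass alpha p.-1 lam f2
                  (subst_lam lam g + uu *: subst_lam lam a
                   + vv *: subst_lam lam p1);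
                polyclass alpha p.-1 lam f3 (vv *: subst_lam lam b)] m].
Proof.
have beta_gt0 : (0 < p.-1)%N by rewrite -subn1 subn_gt0 prime_gt1.
have submodC := code_poly_submod alpha_gt0 beta_gt0 C_constacyclic.
split=> //.
have class_surj (m : polyword alpha p.-1 lam) :
    exists f d, m = polyclass alpha p.-1 lam f d.
  by exists (val m.1), (val m.2); rewrite polyclassK.
have phi_surj (d : {poly Zpuv p}) : exists d', d = comp_poly (lam *: 'X) d'.
  by exists (d \Po (lam ^+ p.-1 *: 'X)); rewrite (comp_lambdaK p_prime lamE).
have Xn_neq0 : 'X^alpha - 1 != 0 :> {poly 'F_p}.
  by rewrite monic_neq0 // monic_Xn_sub_1.
have rhoK (f : {poly 'F_p}) : map_poly (@rho p) (map_poly (@cst p) f) = f.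
  by rewrite -map_poly_comp map_poly_id.
have [f1 [f2 [f3 [g [a [b [q [? ? ? ? genE]]]]]]]] :=
  submodule_generators (polyUU p) (polyUV p) (polyVV p) (@polyZpuvE p)
    rhoK phi_surj (separable_Xpred_sub_1 p_prime)
    (comp_lambda_modulus p_prime lamE) (@polyclass_linear p alpha p.-1 lam)
    class_surj (polyclass0 alpha p.-1 lam)
    (polyclass_modulus_r alpha lam beta_gt0) Xn_neq0
    (polyclass_modulus_l p.-1 lam alpha_gt0) submodC.
exists f1, f2, f3, g, a, b, q; split=> // m.
rewrite in_span3 /subst_lam -comp_poly_combination -comp_polyCl.
exact: genE.
Qed.
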